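(* Let $S,T$ be as in the context. Every $\Sigma_1$ provability predicate $\mathrm{Pr}_T(x)$ of $T$ satisfying $\mathbf{E}^{\mathrm{U}}$ and $\mathbf{CB}_{\exists}$ also satisfies $\mathbf{\Sigma_1C}$.
   Context: $\mathcal{L}_A=\{0,\mathsf{s},+,\times,\leq\}$ is the language of first-order arithmetic, and ''formula'' means $\mathcal{L}_A$-formula; $\ulcorner\varphi\urcorner$ is the numeral of the Gödel number of $\varphi$. $\Sigma_1$ formulas are those of the form $\exists\vec{x}\,\delta$ with $\delta$ a $\Delta_0$ formula. $S$ and $T$ are consistent c.e. extensions of Peano Arithmetic $\mathsf{PA}$ in the language $\mathcal{L}_A$ such that $T$ is stronger than $S$ (every theorem of $S$ is a theorem of $T$; $S=T$ is allowed). A formula $\mathrm{Pr}_T(x)$ is a provability predicate of $T$ if for every formula $\varphi$: $T\vdash\varphi$ if and only if $S\vdash\mathrm{Pr}_T(\ulcorner\varphi\urcorner)$. A $\Sigma_1$ provability predicate is one that is a $\Sigma_1$ formula. $\ulcorner\varphi(\vec{\dot{x}})\urcorner$ is a term with free variables $\vec{x}$ for the primitive recursive function that computes from $\vec{n}$ the Gödel number of $\varphi(\overline{\vec{n}})$, the result of substituting the numerals of $\vec{n}$ for $\vec{x}$ in $\varphi(\vec{x})$. Conditions on $\mathrm{Pr}_T(x)$: - $\mathbf{E}^{\mathrm{U}}$: for all formulas $\varphi(\vec{x}),\psi(\vec{x})$, if $T\vdash\forall\vec{x}\,(\varphi(\vec{x})\leftrightarrow\psi(\vec{x}))$, then $S\vdash\forall\vec{x}\,(\mathrm{Pr}_T(\ulcorner\varphi(\vec{\dot{x}})\urcorner)\leftrightarrow\mathrm{Pr}_T(\ulcorner\psi(\vec{\dot{x}})\urcorner))$.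 - $\mathbf{CB}_{\exists}$: $S\vdash\exists\vec{x}\,\mathrm{Pr}_T(\ulcorner\varphi(\vec{\dot{x}})\urcorner)\to\mathrm{Pr}_T(\ulcorner\exists\vec{x}\,\varphi(\vec{x})\urcorner)$ for every formula $\varphi(\vec{x})$. - $\mathbf{\Sigma_1C}$: $S\vdash\varphi\to\mathrm{Pr}_T(\ulcorner\varphi\urcorner)$ for every $\Sigma_1$ sentence $\varphi$. *)

(* Defs.v *)
From Stdlib Require List.
From mathcomp Require Import all_boot.

Set Implicit Arguments.
Unset Strict Implicit.
Unset Printing Implicit Defensive.

(* Variables are de Bruijn indices. *)
Inductive term : Type :=
| Var of nat
| Zero
| Succ of term
| Add of term & term
| Mul of term & term.

Inductive form : Type :=
| Eq of term & term
| Le of term & term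
| Bot
| Imp of form & form
| And of form & form
| Or of form & form
| All of form
| Ex of form.

Definition Neg (p : form) : form := Imp p Bot.
Definition Iff (p q : form) : form := And (Imp p q) (Imp q p).

Definition alls (k : nat) (p : form) : form := iter k All p.
Definition exs (k : nat) (p : form) : form := iter k Ex p.

Fixpoint numeral (n : nat) : term :=
  if n is m.+1 then Succ (numeral m) else Zero.

Fixpoint tsubst (s : nat -> term) (t : term) : term :=
  match t with
  | Var i => s i
  | Zero => Zero
  | Succ a => Succ (tsubst s a)
  | Add a b => Add (tsubst s a) (tsubst s b)
  | Mul a b => Mul (tsubst s a) (tsubst s b)
  end.

Definition tlift (t : term) : term := tsubst (fun i => Var i.+1) t.

Definition up (s : nat -> term) (i : nat) : term :=
  if i is j.+1 then tlift (s j) else Var 0.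

Fixpoint subst (s : nat -> term) (p : form) : form :=
  match p with
  | Eq a b => Eq (tsubst s a) (tsubst s b)
  | Le a b => Le (tsubst s a) (tsubst s b)
  | Bot => Bot
  | Imp q r => Imp (subst s q) (subst s r)
  | And q r => And (subst s q) (subst s r)
  | Or q r => Or (subst s q) (subst s r)
  | All q => All (subst (up s) q)
  | Ex q => Ex (subst (up s) q)
  end.

Definition flift (p : form) : form := subst (fun i => Var i.+1) p.

(* Index 0 is replaced by [t], the remaining indices go down by one. *)
Definition inst (p : form) (t : term) : form :=
  subst (fun i => if i is j.+1 then Var j else t) p.

(* [bounded k p]: the free variables of [p] are among x_0, ..., x_(k-1). *)
Fixpoint tbounded (k : nat) (t : term) : bool :=
  match t with
  | Var i => i < k
  | Zero => true
  | Succ a => tbounded k a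
  | Add a b | Mul a b => tbounded k a && tbounded k b
  end.

Fixpoint bounded (k : nat) (p : form) : bool :=
  match p with
  | Eq a b | Le a b => tbounded k a && tbounded k b
  | Bot => true
  | Imp q r | And q r | Or q r => bounded k q && bounded k r
  | All q | Ex q => bounded k.+1 q
  end.

Definition sentence (p : form) : Prop := bounded 0 p.

(* The bound of a quantifier is lifted, hence does not mention the quantified
   variable. *)
Inductive Delta0 : form -> Prop :=
| Delta0_Eq a b : Delta0 (Eq a b)
| Delta0_Le a b : Delta0 (Le a b)
| Delta0_Bot : Delta0 Bot
| Delta0_Imp p q : Delta0 p -> Delta0 q -> Delta0 (Imp p q)
| Delta0_And p q : Delta0 p -> Delta0 q -> Delta0 (And p q)
| Delta0_Or p q : Delta0 p -> Delta0 q -> Delta0 (Or p q)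
| Delta0_All t p : Delta0 p -> Delta0 (All (Imp (Le (Var 0) (tlift t)) p))
| Delta0_Ex t p : Delta0 p -> Delta0 (Ex (And (Le (Var 0) (tlift t)) p)).

Definition Sigma1 (p : form) : Prop :=
  exists (k : nat) (d : form), Delta0 d /\ p = exs k d.

Inductive nd : seq form -> form -> Prop :=
| nd_hyp G p : List.In p G -> nd G p
| nd_dn G p : nd (Neg p :: G) Bot -> nd G p
| nd_impI G p q : nd (p :: G) q -> nd G (Imp p q)
| nd_impE G p q : nd G (Imp p q) -> nd G p -> nd G q
| nd_andI G p q : nd G p -> nd G q -> nd G (And p q)
| nd_andE1 G p q : nd G (And p q) -> nd G p
| nd_andE2 G p q : nd G (And p q) -> nd G q
| nd_orI1 G p q : nd G p -> nd G (Or p q)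
| nd_orI2 G p q : nd G q -> nd G (Or p q)
| nd_orE G p q r : nd G (Or p q) -> nd (p :: G) r -> nd (q :: G) r -> nd G r
| nd_allI G p : nd (map flift G) p -> nd G (All p)
| nd_allE G p t : nd G (All p) -> nd G (inst p t)
| nd_exI G p t : nd G (inst p t) -> nd G (Ex p)
| nd_exE G p q : nd G (Ex p) -> nd (p :: map flift G) (flift q) -> nd G q
| nd_eq_refl G t : nd G (Eq t t)
| nd_eq_subst G p s t : nd G (Eq s t) -> nd G (inst p s) -> nd G (inst p t).

(* Theories are sets of axioms. *)
Definition proves (U : form -> Prop) (p : form) : Prop :=
  exists G : seq form, (forall q, List.In q G -> U q) /\ nd G p.

Definition is_theory (U : form -> Prop) : Prop := forall p, U p -> sentence p.

Definition consistent (U : form -> Prop) : Prop := ~ proves U Bot.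

Definition stronger (U V : form -> Prop) : Prop :=
  forall p, proves V p -> proves U p.

Inductive PA : form -> Prop :=
| PA_succ_neq0 : PA (alls 1 (Neg (Eq (Succ (Var 0)) Zero)))
| PA_succ_inj :
    PA (alls 2 (Imp (Eq (Succ (Var 0)) (Succ (Var 1))) (Eq (Var 0) (Var 1))))
| PA_add0 : PA (alls 1 (Eq (Add (Var 0) Zero) (Var 0)))
| PA_addS :
    PA (alls 2 (Eq (Add (Var 0) (Succ (Var 1))) (Succ (Add (Var 0) (Var 1)))))
| PA_mul0 : PA (alls 1 (Eq (Mul (Var 0) Zero) Zero))
| PA_mulS :
    PA (alls 2 (Eq (Mul (Var 0) (Succ (Var 1)))
                   (Add (Mul (Var 0) (Var 1)) (Var 0))))
| PA_le :
    PA (alls 2 (Iff (Le (Var 0) (Var 1))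
                    (Ex (Eq (Add (Var 0) (Var 1)) (Var 2)))))
| PA_induction k p :
    bounded k.+1 p ->
    PA (alls k
         (Imp (inst p Zero)
         (Imp (All (Imp p (subst (fun i => if i is 0 then Succ (Var 0)
                                           else Var i) p)))
              (All p)))).

(* An injective polynomial pairing: x + y is the integer square root of
   [cpair x y]. *)
Definition cpair (x y : nat) : nat := (x + y) * (x + y) + x.
Arguments cpair : simpl never.

(* A term is uniquely s^k(b) with b not a successor; [tcode] computes k and a
   code of b, and its Goedel number is [cpair] of the two.  In particular the
   Goedel number of the numeral of n is [cpair n (cpair 0 0)]. *)
Fixpoint tcode (t : term) : nat * nat :=
  match t with
  | Zero => (0, cpair 0 0)
  | Var i => (0, cpair 1 i)
  | Succ a => ((tcode a).1.+1, (tcode a).2)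
  | Add a b => (0, cpair 2 (cpair (cpair (tcode a).1 (tcode a).2)
                                  (cpair (tcode b).1 (tcode b).2)))
  | Mul a b => (0, cpair 3 (cpair (cpair (tcode a).1 (tcode a).2)
                                  (cpair (tcode b).1 (tcode b).2)))
  end.

Definition tgn (t : term) : nat := cpair (tcode t).1 (tcode t).2.

Fixpoint gn (p : form) : nat :=
  match p with
  | Eq a b => cpair 0 (cpair (tgn a) (tgn b))
  | Le a b => cpair 1 (cpair (tgn a) (tgn b))
  | Bot => cpair 2 0
  | Imp q r => cpair 3 (cpair (gn q) (gn r))
  | And q r => cpair 4 (cpair (gn q) (gn r))
  | Or q r => cpair 5 (cpair (gn q) (gn r))
  | All q => cpair 6 (gn q)
  | Ex q => cpair 7 (gn q)
  end.

Definition corner (p : form) : term := numeral (gn p).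

Definition tpair (a b : term) : term := Add (Mul (Add a b) (Add a b)) a.
Arguments tpair : simpl never.

(* [tcode], [tgn] and [gn] computed by a term of the language, under [d]
   quantifiers of the coded formula: indices below [d] are bound in it, and a
   free variable, of index [d + i], stands for the numeral of the value of
   x_i. *)
Fixpoint tcode_dot (d : nat) (t : term) : term * term :=
  match t with
  | Zero => (Zero, numeral (cpair 0 0))
  | Var i => if i < d then (Zero, numeral (cpair 1 i))
             else (Var (i - d), numeral (cpair 0 0))
  | Succ a => (Succ (tcode_dot d a).1, (tcode_dot d a).2)
  | Add a b =>
      (Zero, tpair (numeral 2)
               (tpair (tpair (tcode_dot d a).1 (tcode_dot d a).2)
                      (tpair (tcode_dot d b).1 (tcode_dot d b).2)))
  | Mul a b =>
      (Zero, tpair (numeral 3)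
               (tpair (tpair (tcode_dot d a).1 (tcode_dot d a).2)
                      (tpair (tcode_dot d b).1 (tcode_dot d b).2)))
  end.

Definition tgn_dot (d : nat) (t : term) : term :=
  tpair (tcode_dot d t).1 (tcode_dot d t).2.

Fixpoint gn_dot (d : nat) (p : form) : term :=
  match p with
  | Eq a b => tpair (numeral 0) (tpair (tgn_dot d a) (tgn_dot d b))
  | Le a b => tpair (numeral 1) (tpair (tgn_dot d a) (tgn_dot d b))
  | Bot => tpair (numeral 2) (numeral 0)
  | Imp q r => tpair (numeral 3) (tpair (gn_dot d q) (gn_dot d r))
  | And q r => tpair (numeral 4) (tpair (gn_dot d q) (gn_dot d r))
  | Or q r => tpair (numeral 5) (tpair (gn_dot d q) (gn_dot d r))
  | All q => tpair (numeral 6) (gn_dot d.+1 q)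
  | Ex q => tpair (numeral 7) (gn_dot d.+1 q)
  end.

Definition corner_dot (p : form) : term := gn_dot 0 p.

Lemma cpair_inj x y x' y' : cpair x y = cpair x' y' -> x = x' /\ y = y'.
Proof.
have lt_cpair a b c e : a + b < c + e -> cpair a b < cpair c e.
  move=> lt_s; rewrite /cpair; apply: leq_trans (leq_addr c _).
  have le_sq : (a + b).+1 * (a + b).+1 <= (c + e) * (c + e) by exact: leq_mul.
  apply: leq_trans le_sq; rewrite mulSn mulnS addnA [X in _ <= X]addnC.
  by rewrite ltn_add2l addSn ltnS -addnA leq_addr.
move=> eq_p; have [lt_s|lt_s|eq_s] := ltngtP (x + y) (x' + y').
- by have := lt_cpair _ _ _ _ lt_s; rewrite eq_p ltnn.
- by have := lt_cpair _ _ _ _ lt_s; rewrite eq_p ltnn.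
move: eq_p; rewrite /cpair eq_s => /addnI eq_x.
by split=> //; move: eq_s; rewrite eq_x => /addnI.
Qed.

Lemma tcode_inj : injective tcode.
Proof.
elim=> [i||a IHa|a IHa b IHb|a IHa b IHb] [j||a'|a' b'|a' b'] // E;
  move: (congr1 fst E) (congr1 snd E) => {E} /=;
  do ?[by [] | by move=> _ /cpair_inj[]].
- by move=> _ /cpair_inj[_ ->].
- by move=> [e1] e2; rewrite (IHa a') //; exact: injective_projections.
- move=> _ /cpair_inj[_ /cpair_inj[/cpair_inj[a1 a2] /cpair_inj[b1 b2]]].
  by congr Add; [apply: IHa|apply: IHb]; exact: injective_projections.
- move=> _ /cpair_inj[_ /cpair_inj[/cpair_inj[a1 a2] /cpair_inj[b1 b2]]].
  by congr Mul; [apply: IHa|apply: IHb]; exact: injective_projections.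
Qed.

Lemma tgn_inj : injective tgn.
Proof.
move=> a b /cpair_inj[e1 e2]; apply: tcode_inj.
exact: injective_projections.
Qed.

Lemma gn_inj : injective gn.
Proof.
elim=> [a b|a b||p IHp q IHq|p IHp q IHq|p IHp q IHq|p IHp|p IHp]
  [a' b'|a' b'||p' q'|p' q'|p' q'|p'|p'] //= /cpair_inj[] // _.
- by move=> /cpair_inj[/tgn_inj-> /tgn_inj->].
- by move=> /cpair_inj[/tgn_inj-> /tgn_inj->].
- by move=> /cpair_inj[/IHp-> /IHq->].
- by move=> /cpair_inj[/IHp-> /IHq->].
- by move=> /cpair_inj[/IHp-> /IHq->].
- by move=> /IHp->.
- by move=> /IHp->.
Qed.

Fixpoint teval (v : nat -> nat) (t : term) : nat :=
  match t with
  | Var i => v i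
  | Zero => 0
  | Succ a => (teval v a).+1
  | Add a b => teval v a + teval v b
  | Mul a b => teval v a * teval v b
  end.

Lemma teval_numeral v n : teval v (numeral n) = n.
Proof. by elim: n => //= n ->. Qed.

Lemma teval_tpair v a b : teval v (tpair a b) = cpair (teval v a) (teval v b).
Proof. by []. Qed.

(* The substitution of the numerals of v(0), v(1), ... under [d] quantifiers. *)
Definition numsubst (v : nat -> nat) (d i : nat) : term :=
  if i < d then Var i else numeral (v (i - d)).

Lemma tlift_numeral n : tlift (numeral n) = numeral n.
Proof. by rewrite /tlift; elim: n => //= n ->. Qed.

Lemma up_numsubst v d : up (numsubst v d) =1 numsubst v d.+1.
Proof.
by case=> [|i] //=; rewrite /numsubst ltnS subSS; case: ifP => // _;
  rewrite tlift_numeral.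
Qed.

Lemma eq_tsubst s s' : s =1 s' -> tsubst s =1 tsubst s'.
Proof. by move=> e; elim=> //= [a ->|a -> b ->|a -> b ->]. Qed.

Lemma eq_subst s s' : s =1 s' -> subst s =1 subst s'.
Proof.
move=> e p.
elim: p s s' e => //= [a b|a b|p IHp q IHq|p IHp q IHq|p IHp q IHq|p IHp|p IHp]
  s s' e; rewrite ?(eq_tsubst e) ?(IHp _ _ e) ?(IHq _ _ e) //.
- by congr All; apply: IHp => -[|i] //=; rewrite e.
- by congr Ex; apply: IHp => -[|i] //=; rewrite e.
Qed.

Lemma tcode_numeral n : tcode (numeral n) = (n, cpair 0 0).
Proof. by elim: n => //= n ->. Qed.

Lemma teval_tcode_dot v d t :
  (teval v (tcode_dot d t).1, teval v (tcode_dot d t).2)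
  = tcode (tsubst (numsubst v d) t).
Proof.
elim: t => [i||a IHa|a IHa b IHb|a IHa b IHb] //.
- rewrite /tcode_dot /tsubst /numsubst.
  by case: ifP => _; rewrite /fst /snd teval_numeral ?tcode_numeral.
- by rewrite [in RHS]/= -IHa.
- by rewrite [in RHS]/= -IHa -IHb.
- by rewrite [in RHS]/= -IHa -IHb.
Qed.

Lemma teval_gn_dot v d p :
  teval v (gn_dot d p) = gn (subst (numsubst v d) p).
Proof.
have E e t : teval v (tgn_dot e t) = tgn (tsubst (numsubst v e) t).
  by rewrite /tgn -teval_tcode_dot.
elim: p d => [a b|a b||p IHp q IHq|p IHp q IHq|p IHp q IHq|p IHp|p IHp] d //;
  rewrite [gn_dot _ _]/= !teval_tpair ?teval_numeral ?E ?IHp ?IHq //=;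
  by rewrite -?E // (eq_subst (up_numsubst v d)).
Qed.

Lemma corner_dotE v p :
  teval v (corner_dot p) = gn (subst (fun i => numeral (v i)) p).
Proof.
rewrite teval_gn_dot; congr gn; apply: eq_subst => i.
by rewrite /numsubst subn0.
Qed.

(* Partial recursive functions, with the graph of their evaluation. *)
Inductive recf : Type :=
| RZero
| RSucc
| RProj of nat
| RComp of recf & seq recf
| RPrec of recf & recf
| RMu of recf.

Inductive reval : recf -> seq nat -> nat -> Prop :=
| ev_zero v : reval RZero v 0
| ev_succ n v : reval RSucc (n :: v) n.+1
| ev_proj i v : i < size v -> reval (RProj i) v (nth 0 v i)
| ev_comp f gs v w y :
    revals gs v w -> reval f w y -> reval (RComp f gs) v y
| ev_prec0 f g v y : reval f v y -> reval (RPrec f g) (0 :: v) y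
| ev_precS f g n v r y :
    reval (RPrec f g) (n :: v) r -> reval g [:: n, r & v] y ->
    reval (RPrec f g) (n.+1 :: v) y
| ev_mu f v n :
    (forall m, m < n -> exists k, reval f (m :: v) k.+1) ->
    reval f (n :: v) 0 -> reval (RMu f) v n
with revals : seq recf -> seq nat -> seq nat -> Prop :=
| evs_nil v : revals [::] v [::]
| evs_cons g gs v y w :
    reval g v y -> revals gs v w -> revals (g :: gs) v (y :: w).

Definition ce (A : nat -> Prop) : Prop :=
  exists f : recf, forall n, A n <-> exists y, reval f [:: n] y.

Definition ce_theory (U : form -> Prop) : Prop :=
  ce (fun n => exists p, U p /\ n = gn p).

Definition ce_extension_PA (U : form -> Prop) : Prop :=
  [/\ is_theory U, ce_theory U, consistent U & stronger U PA].

(* Pr(x) is a formula whose only free variable is index 0, and Pr(t) is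
   [inst Pr t]. *)
Definition provability_predicate (S T : form -> Prop) (Pr : form) : Prop :=
  bounded 1 Pr /\ forall p, proves T p <-> proves S (inst Pr (corner p)).

Definition cond_EU (S T : form -> Prop) (Pr : form) : Prop :=
  forall (k : nat) (p q : form), bounded k p -> bounded k q ->
    proves T (alls k (Iff p q)) ->
    proves S (alls k (Iff (inst Pr (corner_dot p)) (inst Pr (corner_dot q)))).

Definition cond_CBex (S : form -> Prop) (Pr : form) : Prop :=
  forall (k : nat) (p : form), bounded k p ->
    proves S (Imp (exs k (inst Pr (corner_dot p)))
                  (inst Pr (corner (exs k p)))).

Definition cond_Sigma1C (S : form -> Prop) (Pr : form) : Prop :=
  forall p : form, Sigma1 p -> sentence p ->
    proves S (Imp p (inst Pr (corner p))).

(* Main.v *)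
(** In a model of S, call a formula p good if, whenever p(x) holds, Pr(p(x) /\ r(x)) and
    Pr(r(x)) are equivalent for every side formula r; for r a tautology this
    yields p -> Pr(p).  By E^U, Pr does not distinguish T-equivalent formulas
    with parameters, so good formulas are closed under conjunction,
    disjunction, existential quantification and PA-equivalence.  The formula
    x = y is good because it becomes x = x when it is true.  Since the code of
    s(x) for a numeral x is the code of the numeral of x + 1, the equivalences
    x + s(y) = z <-> s(x) + y = z and x * s(y) + u = z <-> x * y + (x + u) = z
    allow an induction inside the model that makes the graphs of + and * good;
    the same induction handles bounded universal quantifiers.  Hence every
    Sigma_1 formula is good.  The completeness theorem transfers this
    reasoning in models to provability in S and T. *)

From Stdlib Require Import Classical ClassicalEpsilon.
From Stdlib Require Import FunctionalExtensionality PropExtensionality.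
From mathcomp Require Import all_boot.
Require Import Defs.

Set Implicit Arguments.
Unset Strict Implicit.
Unset Printing Implicit Defensive.

(** * Substitution *)

Definition scons {A : Type} (d : A) (v : nat -> A) (i : nat) : A :=
  if i is j.+1 then v j else d.
Notation "d .: v" := (scons d v) (at level 55, right associativity).

Lemma scons_eta A (v : nat -> A) : v 0 .: (fun i => v i.+1) = v.
Proof. by apply: functional_extensionality => -[]. Qed.

Lemma tsubst_comp s r t : tsubst s (tsubst r t) = tsubst (fun i => tsubst s (r i)) t.
Proof. by elim: t => //= [a ->|a -> b ->|a -> b ->]. Qed.

Lemma tsubst_Var t : tsubst Var t = t.
Proof. by elim: t => //= [a ->|a -> b ->|a -> b ->]. Qed.

Lemma tsubst_scons_tlift c t : tsubst (c .: Var) (tlift t) = t.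
Proof. by rewrite /tlift tsubst_comp tsubst_Var. Qed.

Lemma tsubst_up_tlift s t : tsubst (up s) (tlift t) = tlift (tsubst s t).
Proof. by rewrite /tlift !tsubst_comp. Qed.

Lemma subst_comp s r p : subst s (subst r p) = subst (fun i => tsubst s (r i)) p.
Proof.
have upE u w : up (fun i => tsubst u (w i)) =1 (fun i => tsubst (up u) (up w i)).
  by case=> //= i; rewrite tsubst_up_tlift.
elim: p s r => //= [a b|a b|p IHp q IHq|p IHp q IHq|p IHp q IHq|p IHp|p IHp] s r;
  by rewrite ?tsubst_comp ?IHp ?IHq // (eq_subst (upE _ _)).
Qed.

Lemma subst_Var p : subst Var p = p.
Proof.
have upE : up Var =1 Var by case.
by elim: p => //= [a b|a b|p -> q ->|p -> q ->|p -> q ->|p|p];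
  rewrite ?tsubst_Var // (eq_subst upE) => ->.
Qed.

Lemma inst_scons p t : inst p t = subst (t .: Var) p.
Proof. by apply: eq_subst; case. Qed.

Lemma inst_up s p t : inst (subst (up s) p) t = subst (t .: s) p.
Proof.
rewrite inst_scons subst_comp; apply: eq_subst => -[|i] //=.
by rewrite /tlift tsubst_comp tsubst_Var.
Qed.

Lemma subst_inst s p t : subst s (inst p t) = inst (subst (up s) p) (tsubst s t).
Proof.
by rewrite inst_up inst_scons subst_comp; apply: eq_subst => -[].
Qed.

Lemma subst_flift s p : subst (up s) (flift p) = flift (subst s p).
Proof. by rewrite /flift !subst_comp. Qed.

(** * Bounds on free variables *)

Lemma tbounded_leq k l t : k <= l -> tbounded k t -> tbounded l t.
Proof.
move=> kl; elim: t => //= [i lt_ik|a IHa b IHb /andP[/IHa-> /IHb->]|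
  a IHa b IHb /andP[/IHa-> /IHb->]] //.
exact: leq_trans kl.
Qed.

Lemma bounded_leq k l p : k <= l -> bounded k p -> bounded l p.
Proof.
elim: p k l => //= [a b|a b|p IHp q IHq|p IHp q IHq|p IHp q IHq|p IHp|p IHp] k l kl.
1,2: by move=> /andP[/(tbounded_leq kl)-> /(tbounded_leq kl)->].
1,2,3: by move=> /andP[/(IHp _ _ kl)-> /(IHq _ _ kl)->].
all: exact: IHp.
Qed.

Lemma eq_in_tsubst k s r t :
  tbounded k t -> (forall i, i < k -> s i = r i) -> tsubst s t = tsubst r t.
Proof.
move=> bt e; elim: t bt => //= [a IHa /IHa->|
  a IHa b IHb /andP[/IHa-> /IHb->]|a IHa b IHb /andP[/IHa-> /IHb->]] //.
Qed.

Lemma eq_in_subst k s r p :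
  bounded k p -> (forall i, i < k -> s i = r i) -> subst s p = subst r p.
Proof.
elim: p k s r => //= [a b|a b|p IHp q IHq|p IHp q IHq|p IHp q IHq|p IHp|p IHp]
  k s r bp e.
1,2: by case/andP: bp => ba bb;
  rewrite (eq_in_tsubst ba e) (eq_in_tsubst bb e).
1,2,3: by case/andP: bp => b1 b2; rewrite (IHp _ _ _ b1 e) (IHq _ _ _ b2 e).
all: by rewrite (IHp _ _ (up r) bp) // => -[|i] //= /e ->.
Qed.

Lemma bounded_subst k l s p :
  bounded k p -> (forall i, i < k -> tbounded l (s i)) -> bounded l (subst s p).
Proof.
have T k' l' s' t : tbounded k' t -> (forall i, i < k' -> tbounded l' (s' i)) ->
    tbounded l' (tsubst s' t).
  move=> bt e; elim: t bt => //= [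
    a IHa b IHb /andP[/IHa-> /IHb->]|a IHa b IHb /andP[/IHa-> /IHb->]] //.
elim: p k l s => //= [a b|a b|p IHp q IHq|p IHp q IHq|p IHp q IHq|p IHp|p IHp]
  k l s bp e.
1,2: by case/andP: bp => ba bb; rewrite (T _ _ _ _ ba e) (T _ _ _ _ bb e).
1,2,3: by case/andP: bp => b1 b2; rewrite (IHp _ _ _ b1 e) (IHq _ _ _ b2 e).
all: apply: (IHp _ _ _ bp) => -[|i] //= /e bi; apply: T bi _ => j //.
Qed.

Lemma leq_cpair1 x y : x <= cpair x y.
Proof. exact: leq_addl. Qed.

Lemma leq_cpair2 x y : y <= cpair x y.
Proof.
apply: leq_trans (leq_addr _ _).
by case: (x + y) (leq_addl x y) => [|n] // le; apply: leq_trans le (leq_pmulr _ _).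
Qed.

Lemma tbounded_tgn t : tbounded (tgn t) t.
Proof.
apply: (@tbounded_leq (tcode t).2); first exact: leq_cpair2.
elim: t => //= [i|a IHa b IHb|a IHa b IHb].
- by rewrite /cpair addn1 ltnS add1n mulSn addSn; apply: leq_trans (leq_addr _ _) _.
all: apply/andP; split.
1,3: apply: tbounded_leq IHa; apply: leq_trans (leq_cpair2 _ _);
  apply: leq_trans (leq_cpair1 _ _); exact: leq_cpair2.
all: apply: tbounded_leq IHb; apply: leq_trans (leq_cpair2 _ _);
  apply: leq_trans (leq_cpair2 _ _); exact: leq_cpair2.
Qed.

(** The index of a variable is below its code, and codes do not decrease from a part to the whole.
    Every formula thus comes with an explicit bound for fresh variables and for universal
    closures. *)
Lemma bounded_gn p : bounded (gn p) p.
Proof.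
elim: p => //= [a b|a b|p IHp q IHq|p IHp q IHq|p IHp q IHq|p IHp|p IHp].
1,2: apply/andP; split;
  [apply: tbounded_leq (tbounded_tgn a)|apply: tbounded_leq (tbounded_tgn b)];
  apply: leq_trans (leq_cpair2 _ _); [exact: leq_cpair1|exact: leq_cpair2].
1,2,3: apply/andP; split; [apply: bounded_leq IHp|apply: bounded_leq IHq];
  apply: leq_trans (leq_cpair2 _ _); [exact: leq_cpair1|exact: leq_cpair2].
all: by apply: bounded_leq IHp; apply: leqW; exact: leq_cpair2.
Qed.

Lemma sentence_alls k p : bounded k p -> sentence (alls k p).
Proof.
rewrite /sentence /alls -[k in bounded k]addn0.
by elim: k 0 p => //= k IHk m p; rewrite addSnnS => /IHk.
Qed.

(** * Structural rules *)

Lemma nd_weaken G H p : nd G p -> (forall q, List.In q G -> List.In q H) -> nd H p.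
Proof.
have in_cons (q : form) K L : (forall r, List.In r K -> List.In r L) ->
    forall r, List.In r (q :: K) -> List.In r (q :: L).
  by move=> KL r [->|/KL]; [left|right].
have in_map (K L : seq form) : (forall r, List.In r K -> List.In r L) ->
    forall r, List.In r (map flift K) -> List.In r (map flift L).
  move=> KL r /List.in_map_iff [q [<- /KL qL]]; exact: List.in_map.
move=> d; elim: d H => {G p}.
- by move=> G p Gp H GH; apply: nd_hyp; exact: GH.
- by move=> G p _ IH H GH; apply: nd_dn; apply: IH; exact: in_cons.
- by move=> G p q _ IH H GH; apply: nd_impI; apply: IH; exact: in_cons.
- by move=> G p q _ IH1 _ IH2 H GH; apply: nd_impE (IH1 _ GH) (IH2 _ GH).
- by move=> G p q _ IH1 _ IH2 H GH; apply: nd_andI (IH1 _ GH) (IH2 _ GH).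
- by move=> G p q _ IH H GH; apply: nd_andE1 (IH _ GH).
- by move=> G p q _ IH H GH; apply: nd_andE2 (IH _ GH).
- by move=> G p q _ IH H GH; apply: nd_orI1 (IH _ GH).
- by move=> G p q _ IH H GH; apply: nd_orI2 (IH _ GH).
- move=> G p q r _ IH1 _ IH2 _ IH3 H GH.
  by apply: nd_orE (IH1 _ GH) _ _; [apply: IH2|apply: IH3]; exact: in_cons.
- by move=> G p _ IH H GH; apply: nd_allI; apply: IH; exact: in_map.
- by move=> G p t _ IH H GH; apply: nd_allE (IH _ GH).
- by move=> G p t _ IH H GH; apply: nd_exI (IH _ GH).
- move=> G p q _ IH1 _ IH2 H GH; apply: nd_exE (IH1 _ GH) _.
  by apply: IH2; apply: in_cons; exact: in_map.
- by move=> *; apply: nd_eq_refl.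
- by move=> G p s t _ IH1 _ IH2 H GH; apply: nd_eq_subst (IH1 _ GH) (IH2 _ GH).
Qed.

(** This serves to rename the fresh variable of a Henkin witness. *)
Lemma nd_subst s G p : nd G p -> nd (map (subst s) G) (subst s p).
Proof.
have mapE r (K : seq form) :
    map (subst (up r)) (map flift K) = map flift (map (subst r) K).
  by rewrite -!map_comp; apply: eq_map => q /=; exact: subst_flift.
move=> d; elim: d s => {G p} /=.
- by move=> G p Gp s; apply: nd_hyp; exact: List.in_map.
- by move=> G p _ IH s; apply: nd_dn; exact: IH.
- by move=> G p q _ IH s; apply: nd_impI; exact: IH.
- by move=> G p q _ IH1 _ IH2 s; apply: nd_impE (IH1 s) (IH2 s).
- by move=> G p q _ IH1 _ IH2 s; apply: nd_andI (IH1 s) (IH2 s).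
- by move=> G p q _ IH s; apply: nd_andE1 (IH s).
- by move=> G p q _ IH s; apply: nd_andE2 (IH s).
- by move=> G p q _ IH s; apply: nd_orI1 (IH s).
- by move=> G p q _ IH s; apply: nd_orI2 (IH s).
- by move=> G p q r _ IH1 _ IH2 _ IH3 s; apply: nd_orE (IH1 s) (IH2 s) (IH3 s).
- by move=> G p _ IH s; apply: nd_allI; rewrite -mapE; exact: IH.
- by move=> G p t _ IH s; rewrite subst_inst; apply: nd_allE (IH s).
- move=> G p t _ IH s; apply: (nd_exI (t := tsubst s t)).
  by rewrite -subst_inst; exact: IH.
- move=> G p q _ IH1 _ IH2 s; apply: nd_exE (IH1 s) _.
  by rewrite -mapE -subst_flift; exact: IH2.
- by move=> *; apply: nd_eq_refl.
- move=> G p a b _ IH1 _ IH2 s; rewrite subst_inst; apply: nd_eq_subst (IH1 s) _.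
  by rewrite -subst_inst; exact: IH2.
Qed.

Lemma nd_hyp0 G p : nd (p :: G) p.
Proof. by apply: nd_hyp; left. Qed.

Lemma nd_hyp1 G p q : nd (q :: p :: G) p.
Proof. by apply: nd_hyp; right; left. Qed.

Lemma nd_weaken1 G p q : nd G p -> nd (q :: G) p.
Proof. by move=> d; apply: nd_weaken d _ => r; right. Qed.

Lemma nd_efq G p : nd G Bot -> nd G p.
Proof. by move=> d; apply: nd_dn; exact: nd_weaken1. Qed.

(** * Provability from sets of formulas *)

Definition adjoin (U : form -> Prop) (p q : form) : Prop := U q \/ q = p.

Lemma proves_hyp (U : form -> Prop) p : U p -> proves U p.
Proof. by exists [:: p]; split; [move=> q [<-|] //|exact: nd_hyp0]. Qed.

Lemma proves_nd1 U p q : nd [:: p] q -> proves U p -> proves U q.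
Proof.
move=> d [G [GU dp]]; exists G; split=> //; apply: nd_impE _ dp.
by apply: nd_impI; apply: nd_weaken d _ => r [->|//]; left.
Qed.

Lemma proves_nd2 U p q r : nd [:: p; q] r -> proves U p -> proves U q -> proves U r.
Proof.
move=> d [G [GU dp]] [H [HU dq]]; exists (G ++ H); split.
  by move=> x /List.in_app_iff[/GU|/HU].
have dGH x K : nd K x -> (K = G \/ K = H) -> nd (G ++ H) x.
  move=> dx e; apply: nd_weaken dx _ => y yK; apply/List.in_app_iff.
  by case: e yK => ->; [left|right].
apply: nd_impE (dGH _ _ dq (or_intror erefl)).
apply: nd_impE (dGH _ _ dp (or_introl erefl)).
apply: nd_impI; apply: nd_impI; apply: nd_weaken d _ => x [->|[->|//]].
  by right; left.
by left.
Qed.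

Lemma proves_impI U p q : proves (adjoin U p) q -> proves U (Imp p q).
Proof.
(* Deleting the occurrences of [p] from [G] leaves a list [H] of axioms in [U] alone. *)
move=> [G [GU dq]]; suff [H [HU GH]] : exists H : seq form,
    (forall x, List.In x H -> U x) /\
    (forall x, List.In x G -> List.In x (p :: H)).
  by exists H; split=> //; apply: nd_impI; apply: nd_weaken dq GH.
elim: G GU {dq} => [|x G IH] GU; first by exists [::].
have [|H [HU GH]] := IH; first by move=> y yG; apply: GU; right.
have [Ux|->] := GU x (or_introl erefl).
  exists (x :: H); split=> [y [<-|/HU] //|y [<-|/GH[->|yH]]].
  - by right; left.
  - by left.
  - by right; right.
exists H; split=> // y [<-|/GH //]; by left.
Qed.

Lemma proves_dn U p : proves (adjoin U (Neg p)) Bot -> proves U p.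
Proof.
move/proves_impI; apply: proves_nd1; apply: nd_dn.
exact: nd_impE (nd_hyp1 _ _ _) (nd_hyp0 _ _).
Qed.

Lemma proves_sub (U V : form -> Prop) p :
  (forall q, U q -> V q) -> proves U p -> proves V p.
Proof. by move=> UV [G [GU d]]; exists G; split=> // q /GU /UV. Qed.

Lemma nd_neg_all G p : nd G (Neg (All p)) -> nd G (Ex (Neg p)).
Proof.
move=> d; apply: nd_dn; apply: nd_impE (nd_weaken1 _ d) _; apply: nd_allI => /=.
apply: nd_dn; apply: nd_impE (nd_hyp1 _ _ _) _.
apply: (nd_exI (t := Var 0)); rewrite inst_scons /= subst_comp.
rewrite (_ : subst _ p = p); first exact: nd_hyp0.
by rewrite -[RHS]subst_Var; apply: eq_subst => -[].
Qed.

(** * Models *)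

Record model : Type := Model {
  dom :> Type;
  mzero : dom;
  msucc : dom -> dom;
  madd : dom -> dom -> dom;
  mmul : dom -> dom -> dom;
  mle : dom -> dom -> Prop }.

Fixpoint eval (M : model) (v : nat -> M) (t : term) : M :=
  match t with
  | Var i => v i
  | Zero => mzero M
  | Succ a => msucc (eval v a)
  | Add a b => madd (eval v a) (eval v b)
  | Mul a b => mmul (eval v a) (eval v b)
  end.

Fixpoint sat (M : model) (v : nat -> M) (p : form) : Prop :=
  match p with
  | Eq a b => eval v a = eval v b
  | Le a b => mle (eval v a) (eval v b)
  | Bot => False
  | Imp q r => sat v q -> sat v r
  | And q r => sat v q /\ sat v r
  | Or q r => sat v q \/ sat v r
  | All q => forall d, sat (d .: v) q
  | Ex q => exists d, sat (d .: v) q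
  end.

Lemma eval_tsubst (M : model) (v : nat -> M) s t :
  eval v (tsubst s t) = eval (fun i => eval v (s i)) t.
Proof. by elim: t => //= [a ->|a -> b ->|a -> b ->]. Qed.

Lemma eval_tlift (M : model) (d : M) v t : eval (d .: v) (tlift t) = eval v t.
Proof. by rewrite eval_tsubst. Qed.

Lemma eval_up (M : model) (d : M) v s :
  (fun i => eval (d .: v) (up s i)) = d .: (fun i => eval v (s i)).
Proof. by apply: functional_extensionality => -[|i] //=; rewrite eval_tlift. Qed.

Lemma forall_ext A (P Q : A -> Prop) : (forall x, P x = Q x) ->
  (forall x, P x) = (forall x, Q x).
Proof. by move=> e; rewrite (functional_extensionality _ _ e). Qed.

Lemma sat_subst (M : model) (v : nat -> M) s p :
  sat v (subst s p) = sat (fun i => eval v (s i)) p.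
Proof.
elim: p v s => //= [a b|a b|p IHp q IHq|p IHp q IHq|p IHp q IHq|p IHp|p IHp] v s;
  rewrite ?eval_tsubst ?IHp ?IHq //.
  by apply: forall_ext => d; rewrite IHp eval_up.
congr ex; apply: functional_extensionality => d; by rewrite IHp eval_up.
Qed.

Lemma sat_inst (M : model) (v : nat -> M) p t :
  sat v (inst p t) = sat (eval v t .: v) p.
Proof.
rewrite inst_scons sat_subst; congr sat.
by apply: functional_extensionality => -[].
Qed.

Lemma sat_flift (M : model) (d : M) v p : sat (d .: v) (flift p) = sat v p.
Proof. by rewrite sat_subst. Qed.

Lemma eval_bounded (M : model) k (v w : nat -> M) t :
  tbounded k t -> (forall i, i < k -> v i = w i) -> eval v t = eval w t.
Proof.
move=> bt e; elim: t bt => //= [a IHa /IHa->|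
  a IHa b IHb /andP[/IHa-> /IHb->]|a IHa b IHb /andP[/IHa-> /IHb->]] //.
Qed.

Lemma sat_bounded (M : model) k (v w : nat -> M) p :
  bounded k p -> (forall i, i < k -> v i = w i) -> sat v p = sat w p.
Proof.
elim: p k v w => //= [a b|a b|p IHp q IHq|p IHp q IHq|p IHp q IHq|p IHp|p IHp]
  k v w bp e.
1,2: by case/andP: bp => ba bb; rewrite (eval_bounded ba e) (eval_bounded bb e).
1,2,3: by case/andP: bp => b1 b2; rewrite (IHp _ _ _ b1 e) (IHq _ _ _ b2 e).
  by apply: forall_ext => d; apply: IHp bp _ => -[|i] //= /e.
congr ex; apply: functional_extensionality => d.
by apply: IHp bp _ => -[|i] //= /e.
Qed.

Lemma sat_alls (M : model) k p :
  (forall v : nat -> M, sat v (alls k p)) <-> (forall v : nat -> M, sat v p).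
Proof.
elim: k p => [|k IHk] p //; rewrite /alls iterSr IHk /=; split=> H v //.
by rewrite -[v]scons_eta.
Qed.

Lemma nd_sound (M : model) (v : nat -> M) G p :
  nd G p -> (forall q, List.In q G -> sat v q) -> sat v p.
Proof.
have cons (w : nat -> M) q K : sat w q -> (forall r, List.In r K -> sat w r) ->
    forall r, List.In r (q :: K) -> sat w r.
  by move=> Hq HK r [<-|/HK].
have lift (w : nat -> M) d K : (forall r, List.In r K -> sat w r) ->
    forall r, List.In r (map flift K) -> sat (d .: w) r.
  by move=> HK r /List.in_map_iff [q [<- /HK]]; rewrite sat_flift.
move=> d; elim: d v => {G p} /=.
- by move=> G p Gp v; exact.
- by move=> G p _ IH v HG; apply: NNPP => np; apply: (IH v); exact: cons.
- by move=> G p q _ IH v HG Hp; apply: IH; exact: cons.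
- by move=> G p q _ IH1 _ IH2 v HG; apply: IH1 => //; exact: IH2.
- by move=> G p q _ IH1 _ IH2 v HG; split; [exact: IH1|exact: IH2].
- by move=> G p q _ IH v /IH[].
- by move=> G p q _ IH v /IH[].
- by move=> G p q _ IH v /IH; left.
- by move=> G p q _ IH v /IH; right.
- move=> G p q r _ IH1 _ IH2 _ IH3 v HG.
  by case: (IH1 v HG) => H; [apply: IH2|apply: IH3]; exact: cons.
- by move=> G p _ IH v HG d; apply: IH; exact: lift.
- by move=> G p t _ IH v HG; rewrite sat_inst; exact: IH.
- by move=> G p t _ IH v /IH; rewrite sat_inst; exists (eval v t).
- move=> G p q _ IH1 _ IH2 v HG; have [d Hd] := IH1 v HG.
  by rewrite -(sat_flift d); apply: IH2; apply: cons => //; exact: lift.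
- by [].
- by move=> G p s t _ IH1 _ IH2 v HG; rewrite sat_inst -IH1 // -sat_inst; exact: IH2.
Qed.

Definition models (M : model) (U : form -> Prop) : Prop :=
  forall p, U p -> forall v : nat -> M, sat v p.

Lemma proves_sound (M : model) U p :
  models M U -> proves U p -> forall v : nat -> M, sat v p.
Proof. by move=> MU [G [GU d]] v; apply: nd_sound d _ => q /GU /MU. Qed.

(** * Completeness *)

Section Henkin.

Variables (U : form -> Prop) (sU : is_theory U) (cU : consistent U).

(* A formula [f] with [gn f = n] has its free variables below [n.+1], and so
   have the formulas of stage [n]: the witness [Var n.+1] is fresh. *)
Fixpoint stage (n : nat) (q : form) : Prop :=
  if n is m.+1 then
    stage m q \/ exists f, [/\ gn f = m, consistent (adjoin (stage m) f) &
      q = f \/ exists2 g, f = Ex g & q = inst g (Var m.+1)]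
  else U q.

Definition henkin (q : form) : Prop := exists n, stage n q.

Lemma bounded_inst_Var k p : bounded k p -> bounded k.+1 (inst p (Var k)).
Proof.
move=> bp; rewrite inst_scons; apply: bounded_subst bp _ => -[|i] //= lt_ik.
by rewrite ltnS ltnW // ltnW.
Qed.

Lemma bounded_stage n q : stage n q -> bounded n.+1 q.
Proof.
elim: n q => [|n IHn] q /=; first by move=> /sU; exact: bounded_leq.
case=> [/IHn|[f [<- _ [->|[g -> ->]]]]].
- exact: bounded_leq.
- by apply: bounded_leq (bounded_gn f); rewrite ltnW.
- apply: bounded_inst_Var; apply: bounded_leq (bounded_gn g) => /=.
  by apply: leqW; exact: leq_cpair2.
Qed.

Lemma stage_leq m n q : m <= n -> stage m q -> stage n q.
Proof. by move=> /subnK <-; elim: (n - m) => //= k IH /IH; left. Qed.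

(* Renaming the fresh variable to index 0 turns a refutation of the witness
   into the premise of the existential elimination rule. *)
Lemma consistent_witness (V : form -> Prop) g m :
  (forall q, V q -> bounded m q) -> bounded m (Ex g) -> V (Ex g) ->
  consistent V -> consistent (adjoin V (inst g (Var m))).
Proof.
move=> bV bg Vg cV /proves_impI [G [GV d]]; apply: cV.
exists (Ex g :: G); split; first by move=> q [<-|/GV].
apply: (nd_exE (p := g)); first exact: nd_hyp0.
pose s i := if i == m then Var 0 else Var i.+1.
have {}d := nd_subst s d.
have eG : map (subst s) G = map flift G.
  elim: G GV {d} => //= q G IH GV; rewrite IH; last by move=> r rG; apply: GV; right.
  congr cons; apply: eq_in_subst (bV _ (GV _ (or_introl erefl))) _ => i lt_im.
  by rewrite /s ltn_eqF.
have eg : subst s (inst g (Var m)) = g.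
  rewrite inst_scons subst_comp -[RHS]subst_Var.
  apply: eq_in_subst (bg : bounded m.+1 g) _.
  by move=> -[|i] /= lt_im; rewrite /s ?eqxx // ltn_eqF.
rewrite eG /= eg in d.
apply: nd_impE (nd_hyp0 _ _); apply: nd_weaken d _ => q qG.
by right; right.
Qed.

(** Since [gn] is injective, each step treats at most one formula: it adds nothing, or a formula
    consistent with the previous stage, in the existential case together with a witness. *)
Lemma consistent_stage n : consistent (stage n).
Proof.
elim: n => // n IHn.
have [[f [ef cf]]|nf] := classic (exists f, gn f = n /\ consistent (adjoin (stage n) f)).
  have bf : bounded n.+1 f by apply: bounded_leq (bounded_gn f); rewrite ef.
  have sub q : stage n.+1 q -> adjoin (stage n) f q \/
      exists2 g, f = Ex g & q = inst g (Var n.+1).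
    case=> [|[h [eh _ H]]]; first by left; left.
    have eq_hf : h = f by apply: gn_inj; rewrite ef.
    by rewrite eq_hf in H; case: H; [left; right|right].
  have [[g eg]|ng] := classic (exists g, f = Ex g); last first.
    apply: contra_not cf; apply: proves_sub => q /sub[//|[g eg _]].
    by case: ng; exists g.
  rewrite eg in bf cf sub.
  have cg : consistent (adjoin (adjoin (stage n) (Ex g)) (inst g (Var n.+1))).
    apply: consistent_witness cf => // [q [/bounded_stage //|-> //]|].
    by right.
  apply: contra_not cg; apply: proves_sub => q /sub[|[_ [<-] ->]]; first by left.
  by right.
apply: contra_not IHn; apply: proves_sub => q /= [//|[f [ef cf _]]].
by case: nf; exists f.
Qed.

(** * Maximality of the Henkin theory and its behaviour under connectives *)

Lemma proves_henkin p : proves henkin p -> exists n, proves (stage n) p.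
Proof.
move=> [G [GH d]]; suff [n Gn] : exists n, forall q, List.In q G -> stage n q.
  by exists n, G.
elim: G GH {d} => [|q G IH] GH; first by exists 0.
have [n Gn] := IH (fun r rG => GH r (or_intror rG)).
have [m qm] := GH q (or_introl erefl).
exists (maxn m n) => r [<-|/Gn]; first exact: stage_leq (leq_maxl _ _) qm.
exact: stage_leq (leq_maxr _ _).
Qed.

Lemma consistent_henkin : consistent henkin.
Proof. by move=> /proves_henkin[n]; exact: consistent_stage. Qed.

(** The step that follows stage [gn p] adds [p] unless this is inconsistent, and then that stage
    already proves the negation. *)
Lemma henkin_or_neg p : henkin p \/ proves henkin (Neg p).
Proof.
have [c|/NNPP nc] := classic (consistent (adjoin (stage (gn p)) p)).
  left; exists (gn p).+1; right; exists p; split=> //; by left.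
by right; apply: proves_sub (proves_impI nc) => q; exists (gn p).
Qed.

Lemma henkin_closed p : proves henkin p -> henkin p.
Proof.
move=> Hp; case: (henkin_or_neg p) => // Hn; case: consistent_henkin.
by apply: proves_nd2 Hn Hp; exact: nd_impE (nd_hyp0 _ _) (nd_hyp1 _ _ _).
Qed.

Lemma henkin_nd1 p q : nd [:: p] q -> henkin p -> henkin q.
Proof.
by move=> d Hp; apply: henkin_closed; apply: proves_nd1 d _; exact: proves_hyp.
Qed.

Lemma henkin_nd2 p q r : nd [:: p; q] r -> henkin p -> henkin q -> henkin r.
Proof.
by move=> d Hp Hq; apply: henkin_closed; apply: proves_nd2 d _ _; exact: proves_hyp.
Qed.

Lemma henkin_Bot : ~ henkin Bot.
Proof. by move/proves_hyp; exact: consistent_henkin. Qed.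

Lemma henkin_Neg p : henkin (Neg p) <-> ~ henkin p.
Proof.
split=> [Hn Hp|]; last by case: (henkin_or_neg p) => // /henkin_closed.
apply: henkin_Bot; apply: henkin_nd2 Hn Hp.
exact: nd_impE (nd_hyp0 _ _) (nd_hyp1 _ _ _).
Qed.

Lemma henkin_Imp p q : henkin (Imp p q) <-> (henkin p -> henkin q).
Proof.
split=> [Hi Hp|H].
  by apply: henkin_nd2 Hi Hp; exact: nd_impE (nd_hyp0 _ _) (nd_hyp1 _ _ _).
have [/H|/henkin_Neg] := classic (henkin p); apply: henkin_nd1; apply: nd_impI.
  exact: nd_hyp1.
by apply: nd_efq; exact: nd_impE (nd_hyp1 _ _ _) (nd_hyp0 _ _).
Qed.

Lemma henkin_And p q : henkin (And p q) <-> henkin p /\ henkin q.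
Proof.
split=> [H|[Hp Hq]].
  by split; apply: henkin_nd1 H; [apply: nd_andE1|apply: nd_andE2]; exact: nd_hyp0.
by apply: henkin_nd2 Hp Hq; apply: nd_andI; [exact: nd_hyp0|exact: nd_hyp1].
Qed.

Lemma henkin_Or p q : henkin (Or p q) <-> henkin p \/ henkin q.
Proof.
split=> [H|[|]]; last 2 first.
- by apply: henkin_nd1; apply: nd_orI1; exact: nd_hyp0.
- by apply: henkin_nd1; apply: nd_orI2; exact: nd_hyp0.
have [|/henkin_Neg Hn] := classic (henkin p); [by left|right].
apply: henkin_nd2 H Hn; apply: nd_orE (nd_hyp0 _ _) _ (nd_hyp0 _ _).
by apply: nd_efq; apply: nd_impE (nd_hyp0 _ _); apply: nd_hyp; right; right; left.
Qed.

Lemma henkin_Ex p : henkin (Ex p) <-> exists t, henkin (inst p t).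
Proof.
split=> [H|[t]]; last by apply: henkin_nd1; apply: nd_exI; exact: nd_hyp0.
(* The stage that adds [Ex p] adds the instance at this variable too; its consistency condition
   holds because everything involved lies in the consistent [henkin]. *)
exists (Var (gn (Ex p)).+1), (gn (Ex p)).+1; right; exists (Ex p).
split=> //; last by right; exists p.
apply: contra_not consistent_henkin; apply: proves_sub => q [|-> //].
by exists (gn (Ex p)).
Qed.

Lemma henkin_All p : henkin (All p) <-> forall t, henkin (inst p t).
Proof.
split=> [H t|H]; first by apply: henkin_nd1 H; apply: nd_allE; exact: nd_hyp0.
apply: NNPP => /henkin_Neg /(henkin_nd1 (nd_neg_all (nd_hyp0 _ _))) /henkin_Ex [t].
by rewrite inst_scons /= -inst_scons => /henkin_Neg; exact.
Qed.

(** * Equality and the term model *)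

Lemma henkin_refl t : henkin (Eq t t).
Proof. by apply: henkin_closed; exists [::]; split=> //; exact: nd_eq_refl. Qed.

Lemma henkin_eq_subst p a b :
  henkin (Eq a b) -> henkin (inst p a) -> henkin (inst p b).
Proof.
by apply: henkin_nd2; apply: nd_eq_subst (nd_hyp0 _ _) (nd_hyp1 _ _ _).
Qed.

Lemma henkin_eq_subst_iff p a b :
  henkin (Eq a b) -> henkin (inst p a) <-> henkin (inst p b).
Proof.
move=> ab; split; first exact: henkin_eq_subst.
apply: henkin_eq_subst.
have := henkin_eq_subst (p := Eq (Var 0) (tlift a)) ab.
rewrite !inst_scons /= !tsubst_scons_tlift; apply; exact: henkin_refl.
Qed.

(** A canonical element of the class of [t] under equality in [henkin]. Equal terms define the same
    predicate, so by extensionality [epsilon] picks the same term for both, and the fixed points of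
    [rep] form the quotient. *)
Definition rep (t : term) : term :=
  epsilon (inhabits Zero) (fun u => henkin (Eq u t)).

Lemma henkin_rep t : henkin (Eq (rep t) t).
Proof.
apply: (@epsilon_spec _ (inhabits Zero) (fun u => henkin (Eq u t))).
by exists t; exact: henkin_refl.
Qed.

Lemma rep_eq a b : henkin (Eq a b) -> rep a = rep b.
Proof.
move=> ab; congr epsilon; apply: functional_extensionality => u.
apply: propositional_extensionality.
have := henkin_eq_subst_iff (Eq (tlift u) (Var 0)) ab.
by rewrite !inst_scons /= !tsubst_scons_tlift.
Qed.

Definition quot : Type := {t | rep t = t}.

Definition cls (t : term) : quot := exist _ (rep t) (rep_eq (henkin_rep t)).

Lemma cls_eq a b : cls a = cls b <-> henkin (Eq a b).
Proof.
split=> [/(congr1 sval) /= e|/rep_eq e]; last first.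
  rewrite /cls; move: (rep_eq (henkin_rep a)) (rep_eq (henkin_rep b)).
  by rewrite e => e1 e2; congr exist; exact: proof_irrelevance.
have Hb := henkin_rep b; rewrite -e in Hb.
have := henkin_eq_subst (p := Eq (Var 0) (tlift b)) (henkin_rep a).
by rewrite !inst_scons /= !tsubst_scons_tlift; exact.
Qed.

Lemma cls_sval (d : quot) : cls (sval d) = d.
Proof.
case: d => t e; rewrite /cls; move: (rep_eq _) => /=.
by rewrite e => e'; congr exist; exact: proof_irrelevance.
Qed.

Lemma henkin_sval_cls t : henkin (Eq (sval (cls t)) t).
Proof. exact: henkin_rep. Qed.

Definition term_model : model :=
  @Model quot (cls Zero) (fun a => cls (Succ (sval a)))
    (fun a b => cls (Add (sval a) (sval b)))
    (fun a b => cls (Mul (sval a) (sval b)))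
    (fun a b => henkin (Le (sval a) (sval b))).

Lemma cls_inst (u : term) a b : henkin (Eq a b) ->
  cls (tsubst (a .: Var) u) = cls (tsubst (b .: Var) u).
Proof.
move=> ab; apply/cls_eq.
have := henkin_eq_subst (p := Eq (tlift (tsubst (a .: Var) u)) u) ab.
rewrite !inst_scons /= !tsubst_scons_tlift; apply; exact: henkin_refl.
Qed.

Lemma term_model_eval (s : nat -> term) t :
  eval (fun i => cls (s i) : term_model) t = cls (tsubst s t).
Proof.
(* The two representatives are replaced one at a time, each by congruence in a single variable. *)
have cls2 (op : term -> term -> term) a b :
    (forall s c d, tsubst s (op c d) = op (tsubst s c) (tsubst s d)) ->
    cls (op (sval (cls a)) (sval (cls b))) = cls (op a b).
  move=> opE; transitivity (cls (op a (sval (cls b)))).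
    have := cls_inst (op (Var 0) (tlift (sval (cls b)))) (henkin_sval_cls a).
    by rewrite !opE !tsubst_scons_tlift.
  have := cls_inst (op (tlift a) (Var 0)) (henkin_sval_cls b).
  by rewrite !opE !tsubst_scons_tlift.
elim: t => //= [a ->|a -> b ->|a -> b ->].
- exact: (cls_inst (Succ (Var 0)) (henkin_sval_cls (tsubst s a))).
- exact: (cls2 Add).
- exact: (cls2 Mul).
Qed.

(** The truth lemma. Every element is the class of its representative, so extending a valuation by
    an element is extending [s] by a term, and quantifiers reduce to instances. *)
Lemma term_model_sat (s : nat -> term) p :
  sat (fun i => cls (s i) : term_model) p <-> henkin (subst s p).
Proof.
have sconsE r d : d .: (fun i => cls (r i)) = (fun i => cls ((sval d .: r) i)).
  by apply: functional_extensionality => -[|i] //=; rewrite cls_sval.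
elim: p s => [a b|a b||p IHp q IHq|p IHp q IHq|p IHp q IHq|p IHp|p IHp] s /=.
- by rewrite !term_model_eval cls_eq.
- rewrite !term_model_eval; set a' := tsubst s a; set b' := tsubst s b.
  have := henkin_eq_subst_iff (Le (Var 0) (tlift (sval (cls b')))) (henkin_sval_cls a').
  have := henkin_eq_subst_iff (Le (tlift a') (Var 0)) (henkin_sval_cls b').
  by rewrite !inst_scons /= !tsubst_scons_tlift => <-.
- by split=> // /henkin_Bot.
- by rewrite henkin_Imp IHp IHq.
- by rewrite henkin_And IHp IHq.
- by rewrite henkin_Or IHp IHq.
- rewrite henkin_All; split=> H t.
    have := H (cls t); rewrite inst_up -IHp; congr sat.
    by apply: functional_extensionality => -[].
  by rewrite sconsE IHp -inst_up; exact: H.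
- rewrite henkin_Ex; split=> -[t H].
    by exists (sval t); rewrite inst_up -IHp -sconsE.
  exists (cls t); move: H; rewrite inst_up -IHp; congr sat.
  by apply: functional_extensionality => -[].
Qed.

End Henkin.

Lemma subst_sentence s p : sentence p -> subst s p = p.
Proof. by move=> sp; rewrite -[RHS]subst_Var; exact: eq_in_subst sp _. Qed.

(** If [p] were unprovable, [U] with the negation of [p] would be consistent, and its term model
    would satisfy [U] and refute [p]. *)
Theorem completeness U p : is_theory U -> sentence p ->
  (forall M, models M U -> forall v : nat -> M, sat v p) -> proves U p.
Proof.
move=> sU sp valid; apply: proves_dn; apply: NNPP => cU.
have sU' : is_theory (adjoin U (Neg p)).
  by move=> q [/sU //|->]; rewrite /sentence /= andbT.
pose M := term_model sU' cU.
have Ms q : adjoin U (Neg p) q -> forall v : nat -> M, sat v q.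
  move=> Uq v; have sq := sU' q Uq.
  have -> : sat v q = sat (fun=> cls sU' cU Zero : M) q by exact: sat_bounded sq _.
  by apply/term_model_sat; rewrite subst_sentence //; exists 0.
apply: (Ms (Neg p) _ (fun=> cls sU' cU Zero)); first by right.
by apply: valid => q Uq; apply: Ms; left.
Qed.

(** * Models of Peano arithmetic *)

Section Arithmetic.

Variables (M : model) (hM : models M PA).
Implicit Types (x y z : M) (v : nat -> M).

Local Notation O := (mzero M).
Local Notation "x ⊕ y" := (madd x y) (at level 50, left associativity).
Local Notation "x ⊗ y" := (mmul x y) (at level 40, left associativity).

Lemma PA_alls k p : PA (alls k p) -> forall v, sat v p.
Proof. by move=> /hM; rewrite sat_alls. Qed.

Lemma msucc_neq0 x : msucc x <> O.
Proof. exact: (PA_alls PA_succ_neq0 (fun=> x)). Qed.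

Lemma msucc_inj x y : msucc x = msucc y -> x = y.
Proof. exact: (PA_alls PA_succ_inj (x .: fun=> y)). Qed.

Lemma madd0 x : x ⊕ O = x.
Proof. exact: (PA_alls PA_add0 (fun=> x)). Qed.

Lemma maddS x y : x ⊕ msucc y = msucc (x ⊕ y).
Proof. exact: (PA_alls PA_addS (x .: fun=> y)). Qed.

Lemma mmul0 x : x ⊗ O = O.
Proof. exact: (PA_alls PA_mul0 (fun=> x)). Qed.

Lemma mmulS x y : x ⊗ msucc y = x ⊗ y ⊕ x.
Proof. exact: (PA_alls PA_mulS (x .: fun=> y)). Qed.

Lemma mleE x y : mle x y <-> exists z, z ⊕ x = y.
Proof. exact: (PA_alls PA_le (x .: fun=> y)). Qed.

(** The axiom for [p] is closed by [gn p] quantifiers, which by [bounded_gn] covers all parameters;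
    hence [v] may be arbitrary. *)
Lemma PA_ind p v : sat (O .: v) p ->
  (forall d, sat (d .: v) p -> sat (msucc d .: v) p) -> forall d, sat (d .: v) p.
Proof.
move=> H0 HS; have bp : bounded (gn p).+1 p by exact: bounded_leq (bounded_gn p).
have := PA_alls (PA_induction bp) v; rewrite /= sat_inst; apply=> // d /HS.
rewrite sat_subst; congr sat; by apply: functional_extensionality => -[].
Qed.

Lemma madd0l x : O ⊕ x = x.
Proof.
apply: (@PA_ind (Eq (Add Zero (Var 0)) (Var 0)) (fun=> O)) => /= [|d IH].
  exact: madd0.
by rewrite maddS IH.
Qed.

Lemma maddSl x y : msucc x ⊕ y = msucc (x ⊕ y).
Proof.
apply: (@PA_ind (Eq (Add (Succ (Var 1)) (Var 0)) (Succ (Add (Var 1) (Var 0))))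
  (fun=> x)) => /= [|d IH]; first by rewrite !madd0.
by rewrite !maddS IH.
Qed.

Lemma maddA x y z : x ⊕ (y ⊕ z) = x ⊕ y ⊕ z.
Proof.
apply: (@PA_ind (Eq (Add (Var 1) (Add (Var 2) (Var 0)))
  (Add (Add (Var 1) (Var 2)) (Var 0))) (x .: fun=> y)) => /= [|d IH].
  by rewrite !madd0.
by rewrite !maddS IH.
Qed.

(** * The order *)

Lemma msucc_cases x : x = O \/ exists y, x = msucc y.
Proof.
apply: (@PA_ind (Or (Eq (Var 0) Zero) (Ex (Eq (Var 1) (Succ (Var 0))))) (fun=> O))
  => /= [|d _]; first by left.
by right; exists d.
Qed.

Lemma madd_succ_neq x y : msucc x ⊕ y <> y.
Proof.
apply: (@PA_ind (Neg (Eq (Add (Succ (Var 1)) (Var 0)) (Var 0))) (fun=> x))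
  => /= [|d IH]; first by rewrite madd0; exact: msucc_neq0.
by rewrite maddS => /msucc_inj.
Qed.

Lemma mle_or_gt x y : mle x y \/ exists z, msucc z ⊕ y = x.
Proof.
rewrite mleE.
apply: (@PA_ind (Or (Ex (Eq (Add (Var 0) (Var 2)) (Var 1)))
  (Ex (Eq (Add (Succ (Var 0)) (Var 1)) (Var 2)))) (fun=> x)) => /= [|d].
  have [->|[z ->]] := msucc_cases x; first by left; exists O; rewrite madd0.
  by right; exists z; rewrite madd0.
case=> [[z <-]|[z <-]]; first by left; exists (msucc z); rewrite maddSl.
have [->|[y' ->]] := msucc_cases z.
  by left; exists O; rewrite madd0l maddSl madd0l.
by right; exists y'; rewrite maddS -maddSl.
Qed.

(** This and [mneqE] replace negated atomic formulas by positive ones. *)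
Lemma not_mle x y : ~ mle x y <-> mle (msucc y) x.
Proof.
have gtE z : z ⊕ msucc y = msucc z ⊕ y by rewrite maddS maddSl.
split=> [H|/mleE[z <-] /mleE[w]].
  by have [//|[z <-]] := mle_or_gt x y; apply/mleE; exists z.
by rewrite gtE maddA maddS; exact: madd_succ_neq.
Qed.

Lemma mle_refl x : mle x x.
Proof. by apply/mleE; exists O; rewrite madd0l. Qed.

Lemma mleS x y : mle x (msucc y) <-> mle x y \/ x = msucc y.
Proof.
split=> [/mleE[z]|[/mleE[z <-]|->]]; last exact: mle_refl.
  have [->|[z' ->]] := msucc_cases z; first by rewrite madd0l; right.
  by rewrite maddSl => /msucc_inj <-; left; apply/mleE; exists z'.
by apply/mleE; exists (msucc z); rewrite maddSl.
Qed.

Lemma mle0 x : mle x O <-> x = O.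
Proof.
split=> [/mleE[z]|->]; last exact: mle_refl.
have [->|[y ->]] := msucc_cases x; first by [].
by rewrite maddS => /msucc_neq0.
Qed.

Lemma mneqE x y : x <> y <-> mle (msucc x) y \/ mle (msucc y) x.
Proof.
have neq (a b : M) : mle (msucc a) b -> a <> b.
  by move=> lt_ab e; case: (proj2 (not_mle b a) lt_ab); rewrite e; exact: mle_refl.
split=> [H|[/neq|/neq e f] //]; last by apply: e.
have [/mleE[z]|[z <-]] := mle_or_gt x y; last first.
  by right; apply/mleE; exists z; rewrite maddS maddSl.
have [->|[z' ->]] := msucc_cases z; first by rewrite madd0l.
by move=> <-; left; apply/mleE; exists z'; rewrite maddS maddSl.
Qed.

(** Sums and products of standard elements are computed as in the natural numbers. This makes Gödel
    numbers of standard formulas correct inside [M]. *)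
Lemma eval_teval (w : nat -> nat) t :
  eval (fun i => iter (w i) (@msucc M) O) t = iter (teval w t) (@msucc M) O.
Proof.
pose num n : M := iter n (@msucc M) O.
have numD m n : num m ⊕ num n = num (m + n).
  by elim: n => [|n IH]; rewrite ?madd0 ?addn0 // addnS /= maddS -/(num n) IH.
elim: t => //= [a -> //|a -> b ->|a -> b ->]; first exact: numD.
elim: (teval w b) => [|n IH]; first by rewrite mmul0 muln0.
by rewrite /= mmulS IH numD mulnS addnC.
Qed.

Lemma eval_numeral v n : eval v (numeral n) = iter n (@msucc M) O.
Proof. by elim: n => //= n ->. Qed.

End Arithmetic.

(** * Gödel numbers of instances *)

(* The terms into which [corner_dot] substitutes without changing shape: the
   code of s^k(x) for a numeral x is computed by s^k applied to x. *)
Fixpoint simple (t : term) : bool :=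
  match t with
  | Var _ | Zero => true
  | Succ a => simple a
  | _ => false
  end.

Lemma iter_upE d s i : iter d up s i =
  if i < d then Var i else tsubst (fun j => Var (j + d)) (s (i - d)).
Proof.
elim: d s i => [|d IHd] s i.
  by rewrite subn0 -[LHS]tsubst_Var; apply: eq_tsubst => j; rewrite addn0.
rewrite iterS; case: i => [|i] //=; rewrite IHd ltnS subSS; case: ifP => // _.
by rewrite /tlift tsubst_comp; apply: eq_tsubst => j /=; rewrite addnS.
Qed.

Section DotSubstitution.

Variables (M : model) (v : nat -> M) (s : nat -> term).
Hypothesis ss : forall i, simple (s i).

(** A simple term over free variables is coded by itself paired with the code of [Zero], exactly as
    a free variable is. A sum would be coded as a sum and not as the numeral of its value, hence the
    hypothesis [ss]. *)
Lemma eval_tcode_dot_subst d t :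
  let c := tcode_dot d (tsubst (iter d up s) t) in
  let w i := eval v (s i) in
  eval v c.1 = eval w (tcode_dot d t).1 /\ eval v c.2 = eval w (tcode_dot d t).2.
Proof.
elim: t => [i||a [IHa1 IHa2]|a [IHa1 IHa2] b [IHb1 IHb2]|
  a [IHa1 IHa2] b [IHb1 IHb2]] //=; last first.
- by rewrite IHa1 IHa2 IHb1 IHb2.
- by rewrite IHa1 IHa2 IHb1 IHb2.
- by rewrite IHa1 IHa2.
rewrite iter_upE; case: ifP => [lt_id|_] /=; first by rewrite lt_id /= !eval_numeral.
elim: (s _) (ss (i - d)) => //= [j _|a IHa /IHa[-> ->] //].
by rewrite ltnNge leq_addl addnK.
Qed.

Lemma eval_gn_dot_subst d p :
  eval v (gn_dot d (subst (iter d up s) p)) = eval (fun i => eval v (s i)) (gn_dot d p).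
Proof.
elim: p d => [a b|a b||p IHp q IHq|p IHp q IHq|p IHp q IHq|p IHp|p IHp] d //=;
  rewrite ?IHp ?IHq ?(IHp d.+1) //.
all: have [-> ->] := eval_tcode_dot_subst d a.
all: by have [-> ->] := eval_tcode_dot_subst d b.
Qed.

End DotSubstitution.

(** * Certified formulas *)

Section Certified.

Variables (S T : form -> Prop) (Pr : form) (M : model).
Hypotheses (sT : is_theory T) (PA_T : stronger T PA) (PA_S : stronger S PA).
Hypotheses (bPr : bounded 1 Pr) (hEU : cond_EU S T Pr) (MS : models M S).
Implicit Types (v : nat -> M) (p q r : form).

(** The model's own claim that [p] is provable at the possibly nonstandard numerals of [v]. The
    constant valuation is harmless, as [Pr] has only index 0 free. *)
Definition box v p : Prop := sat (fun=> eval v (corner_dot p)) Pr.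

Lemma sat_Pr v t : sat v (inst Pr t) = sat (fun=> eval v t) Pr.
Proof. by rewrite sat_inst; apply: sat_bounded bPr _ => -[]. Qed.

Lemma models_PA (N : model) U : stronger U PA -> models N U -> models N PA.
Proof. by move=> UPA NU p /proves_hyp /UPA; exact: proves_sound. Qed.

Let MPA : models M PA := models_PA PA_S MS.

(** By completeness [T] proves the equivalence, closed over enough variables for both formulas, and
    the condition [hEU] carries it under [Pr] in [M]. Stating it as an equality of propositions
    allows rewriting. *)
Lemma box_ext v p q :
  (forall N : model, models N PA -> forall w : nat -> N, sat w p <-> sat w q) ->
  box v p = box v q.
Proof.
move=> pq; pose k := maxn (gn p) (gn q).
have bp : bounded k p := bounded_leq (leq_maxl _ _) (bounded_gn p).
have bq : bounded k q := bounded_leq (leq_maxr _ _) (bounded_gn q).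
have Tpq : proves T (alls k (Iff p q)).
  apply: completeness => // [|N NT].
    by apply: sentence_alls; rewrite /= bp bq.
  by apply/sat_alls => w; exact: pq (models_PA PA_T NT) w.
have := proves_sound MS (hEU bp bq Tpq) => /sat_alls /(_ v) /=.
by rewrite !sat_Pr => -[pq1 pq2]; exact: propositional_extensionality.
Qed.

Lemma box_subst v s p :
  (forall i, simple (s i)) -> box v (subst s p) = box (fun i => eval v (s i)) p.
Proof.
by move=> ss; rewrite /box /corner_dot -(eval_gn_dot_subst v ss 0).
Qed.

Lemma box_flift v d p : box (d .: v) (flift p) = box v p.
Proof. by rewrite /flift box_subst. Qed.

(* Only equivalences are available, so the true formula [p] has to be both
   inserted and removed under [box]; the side formula [r] is what makes this
   property closed under the connectives. *)
Definition certified v p : Prop := forall r, box v (And p r) = box v r.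

(** * Closure of good formulas under logical operations *)

Definition good p : Prop := forall v, sat v p -> certified v p.

(** With [p] inserted on both sides, the conjunct [q] becomes redundant because [p] entails it. *)
Lemma certified_weaken v p q : good p -> sat v p ->
  (forall N : model, models N PA -> forall w : nat -> N, sat w p -> sat w q) ->
  certified v q.
Proof.
move=> gp vp pq r; rewrite -[RHS](gp v vp) -[LHS](gp v vp).
by apply: box_ext => N NPA w /=; have := pq N NPA w; tauto.
Qed.

Lemma good_equiv p q : good p ->
  (forall N : model, models N PA -> forall w : nat -> N, sat w q <-> sat w p) ->
  good q.
Proof.
move=> gp pq v vq; apply: (certified_weaken gp); first exact/pq.
by move=> N NPA w /(pq N NPA).
Qed.

Lemma good_And p q : good p -> good q -> good (And p q).
Proof.
move=> gp gq v [vp vq] r; rewrite -[RHS](gq v vq) -[RHS](gp v vp).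
by apply: box_ext => N NPA w /=; tauto.
Qed.

Lemma good_Or p q : good p -> good q -> good (Or p q).
Proof.
move=> gp gq v [vp|vq]; [apply: (certified_weaken gp vp)|
  apply: (certified_weaken gq vq)] => N NPA w /=; tauto.
Qed.

(** A true witness [d] becomes the value of a new variable that the lifted formulas do not mention.
    There [p] can be inserted, and it entails its own existential closure. *)
Lemma good_Ex p : good p -> good (Ex p).
Proof.
move=> gp v [d vp] r; rewrite -(box_flift v d) -[RHS](box_flift v d).
rewrite -[RHS](gp _ vp) -[LHS](gp _ vp); apply: box_ext => N NPA w /=.
split=> [[H1 [_ H3]] //|[H1 H2]]; split=> //; split=> //.
exists (w 0); rewrite sat_subst; move: H1; congr sat.
by apply: functional_extensionality => -[|i].
Qed.

(* The valuation in which a side formula has to be inserted is duplicated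
   beyond the variables of [p], so that the side formula shares none of them. *)
Lemma good_shift k s p : (forall i, simple (s i)) -> bounded k p ->
  (forall v r, sat v p -> let r' := subst (fun i => Var (i + k)) r in
    box v (And p r') = box v r') ->
  good (subst s p).
Proof.
move=> ss bp gp v; rewrite sat_subst => vp r.
(* Indices below [k] are treated by [s], and those from [k] on return the shifted side formula to
   its original variables. *)
pose s' i := if i < k then s i else Var (i - k).
have ss' i : simple (s' i) by rewrite /s'; case: ifP.
have eq_p : subst s p = subst s' p.
  by apply: eq_in_subst bp _ => i lt_ik; rewrite /s' lt_ik.
have eq_r : r = subst s' (subst (fun i => Var (i + k)) r).
  rewrite subst_comp -[LHS]subst_Var; apply: eq_subst => i /=.
  by rewrite /s' ltnNge leq_addl addnK.
rewrite eq_p [in LHS]eq_r [in RHS]eq_r (box_subst v (And p _) ss') box_subst //.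
by apply: gp; rewrite -sat_subst -eq_p sat_subst.
Qed.

(** * Substitution and induction inside the model *)

Lemma good_subst s p : (forall i, simple (s i)) -> good p -> good (subst s p).
Proof.
by move=> ss gp; apply: (good_shift ss (bounded_gn p)) => v r vp; exact: gp.
Qed.

Lemma good_Eq_Var s : simple s -> good (Eq (tlift s) (Var 0)).
Proof.
move=> ss v /= vs r; pose s' := tlift s .: (fun i => Var i.+1).
have ss' i : simple (s' i) by case: i => //=; elim: s ss {vs s'} => //=.
have vs' : (fun i => eval v (s' i)) = v.
  by apply: functional_extensionality => -[|i].
rewrite -{1}vs' -[in RHS]vs' -!(box_subst v _ ss'); apply: box_ext => N NPA w /=.
by rewrite /tlift tsubst_comp /=; tauto.
Qed.

(** Index 0 of [a] is an accumulator x and index 1 the induction variable y. The good formula [c]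
    relates the next accumulator x' to x and y, and under it a(x, s(y)) reduces to a(x', y).
    Induction on y is carried out in [M], for all x at once. *)
Lemma good_ind a c :
  good c -> good (subst (Var 0 .: Zero .: (fun i => Var i.+1)) a) ->
  (forall N : model, models N PA -> forall (w : nat -> N) x' x y,
    sat (x' .: x .: y .: w) c -> sat (x .: msucc y .: w) a <-> sat (x' .: y .: w) a) ->
  (forall N : model, models N PA -> forall (w : nat -> N) x y,
    sat (x .: msucc y .: w) a -> exists x', sat (x' .: x .: y .: w) c) ->
  good a.
Proof.
(* The two extra variables make the shifted side formula a double lift [r2], free of both x and
   y. *)
move=> gc g0 step1 step2; pose k := (gn a).+2.
have bk : bounded k a by apply: bounded_leq (bounded_gn a); rewrite ltnW.
rewrite -[a]subst_Var; apply: (good_shift (k := k)) => // v r0 va /=.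
pose r := subst (fun i => Var (i + gn a)) r0; pose r2 := subst (fun i => Var i.+2) r.
have -> : subst (fun i => Var (i + k)) r0 = r2.
  by rewrite /r2 /r subst_comp; apply: eq_subst => i /=; rewrite !addnS.
have boxr2 x y w : box (x .: y .: w) r2 = box w r by rewrite /r2 box_subst.
(* The induction formula mentions [Pr] itself; being arithmetical, it falls under the induction
   schema of [M]. *)
pose f := All (Imp a (Iff (inst Pr (corner_dot (And a r2))) (inst Pr (corner_dot r2)))).
have fE y w : sat (y .: w) f <->
    forall x, sat (x .: y .: w) a -> box (x .: y .: w) (And a r2) = box w r.
  rewrite /f [sat _ _]/= ; split=> H x Hx; have := H x Hx; rewrite !sat_Pr -/(box _ _).
    rewrite -/(box _ r2) boxr2 => -[H1 H2].
    exact: propositional_extensionality.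
  by rewrite -/(box _ r2) boxr2 => ->.
have {}va : sat (v 0 .: v 1 .: fun i => v i.+2) a.
  by rewrite (_ : _ .: _ = v) //; apply: functional_extensionality => -[|[|i]].
have -> : v = v 0 .: v 1 .: fun i => v i.+2.
  by apply: functional_extensionality => -[|[|i]].
rewrite boxr2; move: (v 0) (v 1) (fun i => v i.+2) va => x y {}v va.
move: x va; apply/fE; move: y; apply: (PA_ind MPA);
  last move=> y /fE IHy; apply/fE => x va.
  (* In the base case the value zero of y is expressed by the simple term [Zero], which gives the
     formula treated by [g0]. *)
  pose s := Var 0 .: Zero .: fun i => Var i.+1.
  have ss i : simple (s i) by case: i => [|[|i]].
  have vs : (fun i => eval (x .: v) (s i)) = x .: mzero M .: v.
    by apply: functional_extensionality => -[|[|i]].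
  rewrite -(boxr2 x (mzero M)) -vs -!box_subst //.
  by apply: g0; rewrite sat_subst vs.
have [x' Hc] := step2 M MPA v x y va.
have va' := (step1 M MPA v x' x y Hc).1 va.
(* Over the variables x', x, y, the substitution [s1] yields a(x, s(y)) and [s2] yields a(x', y). *)
pose s1 := Var 1 .: Succ (Var 2) .: fun i => Var i.+3.
pose s2 := Var 0 .: Var 2 .: fun i => Var i.+3.
have ss1 i : simple (s1 i) by case: i => [|[|i]].
have ss2 i : simple (s2 i) by case: i => [|[|i]].
have evs1 (N : model) (w : nat -> N) :
    (fun i => eval w (s1 i)) = w 1 .: msucc (w 2) .: fun i => w i.+3.
  by apply: functional_extensionality => -[|[|i]].
have evs2 (N : model) (w : nat -> N) :
    (fun i => eval w (s2 i)) = w 0 .: w 2 .: fun i => w i.+3.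
  by apply: functional_extensionality => -[|[|i]].
rewrite -(IHy x' va'); pose u := x' .: x .: y .: v.
rewrite -[x .: _](evs1 M u) -[x' .: _](evs2 M u) -!box_subst //.
(* Once [c] is inserted on both sides, [step1] makes the boxed formulas equivalent in every model of
   PA. *)
rewrite -[LHS](gc u Hc) -[RHS](gc u Hc); apply: box_ext => N NPA w /=.
rewrite /r2 !sat_subst evs1 evs2 /=.
have := step1 N NPA (fun i => w i.+3) (w 0) (w 1) (w 2).
rewrite (_ : w 0 .: _ = w); first tauto.
by apply: functional_extensionality => -[|[|[|i]]].
Qed.

(** * Atomic formulas and their negations *)

Lemma good_Eq_Vars i j : good (Eq (Var i) (Var j)).
Proof.
apply: (good_subst (s := Var j .: fun=> Var i) _ (good_Eq_Var (s := Var 0) _)) => //.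
by case.
Qed.
Arguments good_Eq_Vars : clear implicits.

Lemma good_Add_Var : good (Eq (Add (Var 0) (Var 1)) (Var 2)).
Proof.
apply: (good_ind (c := Eq (Succ (Var 1)) (Var 0))).
- exact: (good_Eq_Var (s := Succ (Var 0))).
- apply: (good_equiv (good_Eq_Vars 0 1)) => N NPA w /=.
  by rewrite (madd0 NPA).
- by move=> N NPA w x' x y /= <-; rewrite (maddS NPA) (maddSl NPA).
- by move=> N NPA w x y _; exists (msucc x).
Qed.

(* The accumulator [Var 0] makes the multiplication tail recursive. *)
Lemma good_Mul_Add_Var : good (Eq (Add (Mul (Var 2) (Var 1)) (Var 0)) (Var 3)).
Proof.
apply: (good_ind (c := Eq (Add (Var 3) (Var 1)) (Var 0))).
- apply: (good_subst (s := Var 3 .: Var 1 .: fun=> Var 0) _ good_Add_Var).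
  by case=> [|[|i]].
- apply: (good_equiv (good_Eq_Vars 0 2)) => N NPA w /=.
  by rewrite (mmul0 NPA) (madd0l NPA).
- by move=> N NPA w x' x y /= <-; rewrite (mmulS NPA) (maddA NPA).
- by move=> N NPA w x y _; exists (madd (w 0) x).
Qed.

Lemma good_Mul_Var : good (Eq (Mul (Var 0) (Var 1)) (Var 2)).
Proof.
(* The accumulator starts at zero, and the other variables are renamed to match. *)
have ss i : simple ((Zero .: Var 1 .: Var 0 .: fun=> Var 2) i).
  by case: i => [|[|[|i]]].
apply: (good_equiv (good_subst ss good_Mul_Add_Var)) => N NPA w /=.
by rewrite (madd0 NPA).
Qed.

(** Existential variables name the values of the immediate subterms, which leaves only graphs of
    single operations on variables. The renaming [s] makes room for these variables in the
    induction. *)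
Lemma good_graph t (s : nat -> nat) j : good (Eq (tsubst (fun i => Var (s i)) t) (Var j)).
Proof.
elim: t s j => [i||a IHa|a IHa b IHb|a IHa b IHb] s j /=.
- exact: good_Eq_Vars.
- by apply: (good_subst (s := fun=> Var j) _ (good_Eq_Var (s := Zero) _)).
- have gS : good (Eq (Succ (Var 0)) (Var j.+1)).
    apply: (good_subst (s := Var j.+1 .: fun=> Var 0) _
      (good_Eq_Var (s := Succ (Var 0)) _)) => //.
    by case.
  apply: (good_equiv (good_Ex (good_And (IHa (fun i => (s i).+1) 0) gS))) => N NPA w /=.
  rewrite !eval_tsubst /=; split=> [<-|[d [H <-]]]; last by rewrite -H eval_tsubst.
  by exists (eval (fun i => w (s i)) a); rewrite eval_tsubst.
- have gD : good (Eq (Add (Var 0) (Var 1)) (Var j.+2)).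
    apply: (good_subst (s := Var 0 .: Var 1 .: fun=> Var j.+2) _ good_Add_Var).
    by case=> [|[|i]].
  apply: (good_equiv (good_Ex (good_Ex (good_And (IHa (fun i => (s i).+2) 0)
    (good_And (IHb (fun i => (s i).+2) 1) gD))))) => N NPA w /=.
  split=> [<-|[d [e [Ha [Hb <-]]]]]; last first.
    by move: Ha Hb; rewrite !eval_tsubst /= => <- <-.
  exists (eval (fun i => w (s i)) b), (eval (fun i => w (s i)) a).
  by rewrite !eval_tsubst.
- have gM : good (Eq (Mul (Var 0) (Var 1)) (Var j.+2)).
    apply: (good_subst (s := Var 0 .: Var 1 .: fun=> Var j.+2) _ good_Mul_Var).
    by case=> [|[|i]].
  apply: (good_equiv (good_Ex (good_Ex (good_And (IHa (fun i => (s i).+2) 0)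
    (good_And (IHb (fun i => (s i).+2) 1) gM))))) => N NPA w /=.
  split=> [<-|[d [e [Ha [Hb <-]]]]]; last first.
    by move: Ha Hb; rewrite !eval_tsubst /= => <- <-.
  exists (eval (fun i => w (s i)) b), (eval (fun i => w (s i)) a).
  by rewrite !eval_tsubst.
Qed.
Arguments good_graph : clear implicits.

Lemma good_Eq a b : good (Eq a b).
Proof.
apply: (good_equiv (good_Ex (good_And (good_graph a succn 0) (good_graph b succn 0)))).
move=> N NPA w /=; rewrite -!/(tlift _); split=> [e|[d]].
  by exists (eval w a); rewrite !eval_tlift.
by rewrite !eval_tlift => -[-> ->].
Qed.
Arguments good_Eq : clear implicits.

Lemma good_Le a b : good (Le a b).
Proof.
apply: (good_equiv (good_Ex (good_Eq (Add (Var 0) (tlift a)) (tlift b)))).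
move=> N NPA w /=; rewrite (mleE NPA).
by split=> -[d H]; exists d; move: H; rewrite !eval_tlift.
Qed.
Arguments good_Le : clear implicits.

Lemma good_Neg_Le a b : good (Neg (Le a b)).
Proof. by apply: (good_equiv (good_Le (Succ b) a)) => N NPA w; exact: not_mle. Qed.

Lemma good_Neg_Eq a b : good (Neg (Eq a b)).
Proof.
apply: (good_equiv (good_Or (good_Le (Succ a) b) (good_Le (Succ b) a))).
by move=> N NPA w; exact: mneqE.
Qed.

(** * Bounded quantifiers and Σ1 formulas *)

Lemma good_ball t p : good p -> good (All (Imp (Le (Var 0) (tlift t)) p)).
Proof.
move=> gp.
(* The bound is the induction variable y, and index 1 under the quantifier is an idle accumulator.
   Given p(s(y)), playing the role of [c], the bound s(y) reduces to y. *)
pose a := All (Imp (Le (Var 0) (Var 2)) (subst (Var 0 .: fun i => Var i.+3) p)).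
have sata (N : model) (x y : N) w :
    sat (x .: y .: w) a <-> forall d, mle d y -> sat (d .: w) p.
  have satp d : sat (d .: x .: y .: w) (subst (Var 0 .: fun i => Var i.+3) p)
      = sat (d .: w) p.
    by rewrite sat_subst; congr sat; apply: functional_extensionality => -[].
  by rewrite /a /=; split=> H d; have := H d; rewrite satp.
have ga : good a.
  have ssc i : simple ((Succ (Var 2) .: fun i => Var i.+3) i) by case: i.
  have ss0 i : simple ((Zero .: fun i => Var i.+1) i) by case: i.
  have satc (N : model) (d x y : N) w :
      sat (d .: x .: y .: w) (subst (Succ (Var 2) .: fun i => Var i.+3) p)
      = sat (msucc y .: w) p.
    by rewrite sat_subst; congr sat; apply: functional_extensionality => -[].
  apply: (good_ind (good_subst ssc gp)).
  - apply: (good_equiv (good_subst ss0 gp)) => N NPA w; rewrite !sat_subst.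
    have -> : (fun i => eval w ((Zero .: fun i => Var i.+1) i))
        = mzero N .: fun i => w i.+1.
      by apply: functional_extensionality => -[].
    have -> : (fun i => eval w ((Var 0 .: Zero .: fun i => Var i.+1) i))
        = w 0 .: mzero N .: fun i => w i.+1.
      by apply: functional_extensionality => -[|[|i]].
    rewrite sata; split=> [|H d /(mle0 NPA) -> //]; by apply; exact/(mle0 NPA).
  - move=> N NPA w x' x y; rewrite satc !sata => Hy.
    split=> H d; first by move=> le_dy; apply: H; apply/(mleS NPA); left.
    by move=> /(mleS NPA) [/H //|->].
  - move=> N NPA w x y /sata H; exists x; rewrite satc; apply: H; exact: mle_refl.
have ss i : simple ((Var 0 .: Var 0 .: fun i => Var i.+1) i) by case: i => [|[|i]].
(* An arbitrary [t] need not be simple, so a new variable equal to it serves as the bound; the idle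
   accumulator receives the same value. *)
apply: (good_equiv (good_Ex (good_And (good_Eq (tlift t) (Var 0)) (good_subst ss ga)))).
move=> N NPA w.
have satE d : sat (d .: w) (subst (Var 0 .: Var 0 .: fun i => Var i.+1) a)
    <-> forall e, mle e d -> sat (e .: w) p.
  rewrite sat_subst -(sata N d d).
  have -> // : (fun i => eval (d .: w) ((Var 0 .: Var 0 .: fun i => Var i.+1) i))
      = d .: d .: w.
  by apply: functional_extensionality => -[|[|i]].
split=> [H|[d [/= + /satE H] e]].
  exists (eval w t); split; first by rewrite /= eval_tlift.
  by apply/satE => e He; apply: H; rewrite /= eval_tlift.
by rewrite !eval_tlift => ->; exact: H.
Qed.
Arguments good_ball t [p] gp.

(** Both halves are proved together: an implication is treated as a disjunction with a negated
    premise, and negations are pushed through bounded quantifiers by duality. *)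
Lemma good_Delta0 p : Delta0 p -> good p /\ good (Neg p).
Proof.
elim=> {p} [a b|a b||p q _ [gp gnp] _ [gq gnq]|p q _ [gp gnp] _ [gq gnq]|
  p q _ [gp gnp] _ [gq gnq]|t p _ [gp gnp]|t p _ [gp gnp]].
- by split; [exact: good_Eq|exact: good_Neg_Eq].
- by split; [exact: good_Le|exact: good_Neg_Le].
- split; first by move=> v [].
  by apply: (good_equiv (good_Eq Zero Zero)) => N NPA w /=; tauto.
- split; [apply: (good_equiv (good_Or gnp gq))|apply: (good_equiv (good_And gp gnq))];
    move=> N NPA w /=; have := classic (sat w p); tauto.
- split; [exact: good_And|apply: (good_equiv (good_Or gnp gnq))].
  by move=> N NPA w /=; have := classic (sat w p); tauto.
- split; [exact: good_Or|apply: (good_equiv (good_And gnp gnq))].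
  by move=> N NPA w /=; tauto.
- split; first exact: good_ball.
  apply: (good_equiv (good_Ex (good_And (good_Le (Var 0) (tlift t)) gnp))).
  move=> N NPA w /=; split=> [/not_all_ex_not [d H]|[d [H1 H2]] H].
    by exists d; tauto.
  by apply: H2; exact: H.
- split; first exact: good_Ex (good_And (good_Le _ _) gp).
  apply: (good_equiv (good_ball t gnp)) => N NPA w /=.
  by split=> [H d H1 H2|H [d [H1 H2]]]; [apply: H; exists d|exact: H H1 H2].
Qed.

Lemma good_Sigma1 p : Sigma1 p -> good p.
Proof.
move=> [k [d [/good_Delta0[gd _] ->]]].
by elim: k => //= k; exact: good_Ex.
Qed.

(** The zero valuation is standard, so the code is computed as in the natural numbers, and
    substituting numerals leaves a sentence unchanged. *)
Lemma box_sentence p : sentence p ->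
  box (fun=> mzero M) p = sat (fun=> mzero M) (inst Pr (corner p)).
Proof.
move=> sp; rewrite sat_Pr /box /corner eval_numeral (eval_teval MPA (fun=> 0)).
by rewrite corner_dotE subst_sentence.
Qed.

End Certified.

(** * Provable Σ1-completeness *)

Theorem theorem3p11 (S T : form -> Prop)
  (hS : ce_extension_PA S) (hT : ce_extension_PA T) (hST : stronger T S)
  (Pr : form) (hPr : provability_predicate S T Pr) (hSigma : Sigma1 Pr)
  (hEU : cond_EU S T Pr) (hCB : cond_CBex S Pr) :
  cond_Sigma1C S Pr.
Proof.
case: hS hT hPr => sS _ _ PA_S [sT _ _ PA_T] [bPr prT] p Sp sp.
have bc : sentence (inst Pr (corner p)).
  rewrite /sentence inst_scons; apply: bounded_subst bPr _ => -[|//] _ /=.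
  by rewrite /corner; elim: (gn p).
apply: completeness => // [|M MS v]; first by rewrite /sentence /=; apply/andP.
have -> : sat v (Imp p (inst Pr (corner p)))
    = sat (fun=> mzero M) (Imp p (inst Pr (corner p))).
  by apply: (sat_bounded (k := 0)) => //=; apply/andP.
(* [T] proves [top], so [Pr] holds of it in [M]. As [p] is good and true, it can be inserted beside
   [top], and the conjunction is equivalent to [p]. *)
move=> vp; pose top := Imp Bot Bot.
have box_top : box Pr (fun=> mzero M) top.
  rewrite (box_sentence PA_S bPr MS) //; apply: (proves_sound MS).
  apply/prT; exists [::]; split=> //; apply: nd_impI; exact: nd_hyp0.
rewrite -(box_sentence PA_S bPr MS) //.
rewrite -(good_Sigma1 sT PA_T PA_S bPr hEU MS Sp vp) in box_top.
rewrite (_ : box _ _ p = box Pr (fun=> mzero M) (And p top)) //.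
apply: (box_ext sT PA_T bPr hEU MS) => N NPA w /=; tauto.
Qed.
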